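(* Let $G$ be a finite, simple, connected $3$-$\gamma_{c}$-critical graph such that $G \notin \mathcal{G}_{2}(3,3)$. Then for every $q \in \{1,2\}$, $\alpha(G) = \kappa(G) + q$ if and only if $\alpha(G) = \delta(G) + q$.
   Context: All graphs are finite, simple and connected. A set $D \subseteq V(G)$ is a connected dominating set of $G$ if every vertex of $G$ is in $D$ or adjacent to a vertex of $D$, and $G[D]$ is connected; $\gamma_{c}(G)$ is the minimum size of such a set. For non-adjacent $u,v$, $G+uv$ is $G$ with edge $uv$ added. $G$ is $3$-$\gamma_{c}$-critical if $\gamma_{c}(G)=3$ and $\gamma_{c}(G+uv)<3$ for every pair of non-adjacent vertices $u,v$. $\alpha(G)$ is the independence number, $\delta(G)$ the minimum degree, $\kappa(G)$ the connectivity (minimum size of a vertex set whose removal disconnects $G$). The class $\mathcal{G}_{2}(3,3)$: take integers $j_1, j_2 \geq 3$, pairwise disjoint vertex sets $J_1, J_2$ with $|J_1| = j_1$, $|J_2| = j_2$, two distinct vertices $u_1, u_2 \in J_2$, and three further vertices $w, w_1, v_1$. Form the graph on $J_1 \cup J_2 \cup \{w, w_1, v_1\}$ whose edges are exactly: all edges inside $J_1$, all edges inside $J_2$, $v_1$ joined to every vertex of $J_1$, $w_1$ joined to every vertex of $J_1 \cup (J_2 \setminus \{u_1\}) \cup \{w\}$, and $w$ joined to every vertex of $J_1 \cup (J_2 \setminus \{u_2\}) \cup \{w_1\}$. $\mathcal{G}_{2}(3,3)$ is the class of all graphs (up to isomorphism) obtained this way. *)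

(* Defs.v *)
From mathcomp Require Import all_boot.

Set Implicit Arguments.
Unset Strict Implicit.
Unset Printing Implicit Defensive.

(* A simple graph on the vertex set [T] is a relation [e : rel T] that is
   symmetric and irreflexive; these two hypotheses are stated where used. *)

Section GraphParameters.

Variables (T : finType) (e : rel T).
Implicit Types (D S : {set T}).

Definition induced D : rel T := [rel x y | [&& x \in D, y \in D & e x y]].

Definition connected_in D : bool :=
  [forall x in D, forall y in D, connect (induced D) x y].

Definition connected_graph : bool := connected_in [set: T].

Definition dominating D : bool :=
  [forall x, (x \in D) || [exists y in D, e x y]].

Definition connected_dominating D : bool := dominating D && connected_in D.

(* The default value of the iterated [minn] is never below the true minimum: in
   a connected graph [set: T] is itself a connected dominating set. *)
Definition gamma_c : nat :=
  \big[minn/#|T|]_(D : {set T} | connected_dominating D) #|D|.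

Definition independent S : bool := [forall x in S, forall y in S, ~~ e x y].

Definition independence_number : nat :=
  \max_(S : {set T} | independent S) #|S|.

Definition degree (x : T) : nat := #|[set y | e x y]|.

Definition min_degree : nat := \big[minn/#|T|]_(x : T) degree x.

Definition vertex_cut S : bool := ~~ connected_in (~: S).

(* A vertex cut has at most [#|T| - 2] elements, so the default value is
   reached only when there is none, i.e. for complete graphs. *)
Definition connectivity : nat :=
  \big[minn/#|T|.-1]_(S : {set T} | vertex_cut S) #|S|.

Definition add_edge (u v : T) : rel T :=
  [rel x y | [|| e x y, (x == u) && (y == v) | (x == v) && (y == u)]].

End GraphParameters.

Definition critical3 (T : finType) (e : rel T) : Prop :=
  gamma_c e = 3 /\
  forall u v : T, u != v -> ~~ e u v -> gamma_c (add_edge e u v) < 3.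

(* Each edge of the construction, oriented in one direction. *)
Definition G2_edge (T : finType) (J1 J2 : {set T}) (u1 u2 w w1 v1 : T) : rel T :=
  [rel x y |
    [|| [&& x \in J1, y \in J1 & x != y],
        [&& x \in J2, y \in J2 & x != y],
        (x == v1) && (y \in J1),
        (x == w1) && (y \in J1 :|: (J2 :\ u1) :|: [set w]) |
        (x == w) && (y \in J1 :|: (J2 :\ u2) :|: [set w1])]].

(* Closed under isomorphism, since the pieces of the construction are sought
   inside the vertex set of the given graph. *)
Definition in_G2_33 (T : finType) (e : rel T) : Prop :=
  exists (J1 J2 : {set T}) (u1 u2 w w1 v1 : T),
    [/\ [/\ 3 <= #|J1|, 3 <= #|J2| & [disjoint J1 & J2]],
        [/\ u1 \in J2, u2 \in J2 & u1 != u2],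
        uniq [:: w; w1; v1] /\ [disjoint [set w; w1; v1] & J1 :|: J2],
        J1 :|: J2 :|: [set w; w1; v1] = [set: T]
      & forall x y : T,
          e x y = G2_edge J1 J2 u1 u2 w w1 v1 x y
               || G2_edge J1 J2 u1 u2 w w1 v1 y x].

(* Main.v *)
Require Import Defs.
From mathcomp Require Import all_boot all_order.

(* Since kappa <= delta, it suffices to show that kappa < delta and alpha > kappa
   force the graph into G_2(3,3).  Criticality says that two non-adjacent vertices
   u, v either dominate the graph together, or there is a witness x such that the
   edge ux dominates everything but v (or the same with u and v exchanged).  In
   an independent set I with at least three elements the first case is
   impossible, so I carries a tournament whose arcs u -> v have witnesses missing
   exactly v in I.

   Let S be a minimum cut separating A from B.  As |S| < delta, both sides have
   at least two vertices, so an arc starting outside S has its witness in S.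
   Counting witnesses shows that I \ S has a source a0 and that S \ I is in
   bijection with the other vertices of I \ S.  Domination arguments then rule
   out everything except |S| = 2 with I meeting S, A and B in one vertex each.
   Applying this to further independent triples determines all the edges. *)

Set Implicit Arguments.
Unset Strict Implicit.
Unset Printing Implicit Defensive.

(** * Witnesses, separations and independent sets for an abstract domination relation *)

Section Domination.

(* [d] stands for closed adjacency (equal or adjacent): [d u z] reads
   "u dominates z". *)
Variables (T : finType) (d : rel T).
Implicit Types (S A B I : {set T}).

Definition covers u v := forall z, d u z || d v z.

(** This is what a connected dominating pair {u, x} of G + uv that avoids v leaves in G: only v
    relied on the added edge. *)
Definition witness u x v :=
  [/\ d u x, ~~ d u v, ~~ d x v & forall z, z != v -> d u z || d x z].

(** [sep_nbrA] and [sep_nbrB] hold once [#|S|] is below every degree: each vertex then has a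
    neighbour outside [S], necessarily on its own side. *)
Record separation S A B : Prop := Separation {
  sep_cover : forall z, [|| z \in S, z \in A | z \in B];
  sep_SA : forall z, z \in A -> z \notin S;
  sep_SB : forall z, z \in B -> z \notin S;
  sep_AB : forall a b, a \in A -> b \in B -> d a b = false;
  sep_neA : exists a, a \in A;
  sep_neB : exists b, b \in B;
  sep_nbrA : forall a, a \in A -> exists2 a', a' \in A & (a' != a) && d a a';
  sep_nbrB : forall b, b \in B -> exists2 b', b' \in B & (b' != b) && d b b' }.

Definition independent_for I := {in I &, forall u v, d u v = (u == v)}.

Record pivot S I a0 : Prop := Pivot {
  pivot_in : a0 \in I;
  pivot_out : a0 \notin S;
  pivot_miss : forall x, x \in S -> x \notin I ->
    exists v, [/\ v \in I, v \notin S, v != a0, witness a0 x v &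
                  {in I, forall w, d x w = (w != v)}];
  pivot_witness : forall v, v \in I -> v \notin S -> v != a0 ->
    exists x, [/\ x \in S, x \notin I & witness a0 x v];
  pivot_inj : forall x y v, x \in S -> x \notin I -> y \in S -> y \notin I ->
    v \in I -> ~~ d x v -> ~~ d y v -> x = y }.

(* In the notation of G_2(3,3): [x] is w, [s] is w_1, [a0] is u_1, [a1] is v_1,
   [A :\ a1] is J_1 and [B] is J_2. *)
Record two_cut S A B I s x a0 a1 : Prop := TwoCut {
  tc_I : I = [set s; a0; a1];
  tc_S : S = [set s; x];
  tc_sx : s != x;
  tc_a0 : a0 \in B;
  tc_a1 : a1 \in A;
  tc_xs : d x s;
  tc_xa0 : d x a0;
  tc_xa1 : ~~ d x a1;
  tc_xA : forall a, a \in A -> a != a1 -> d x a;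
  tc_sB : forall b, b \in B -> b != a0 -> d s b;
  tc_miss : exists2 b, b \in B & ~~ d x b }.

Hypotheses (dxx : reflexive d) (dC : symmetric d).
Hypothesis no_dominating_edge :
  forall u x, d u x -> exists2 z, ~~ d u z & ~~ d x z.
Hypothesis critical : forall u v, ~~ d u v ->
  [\/ covers u v, exists x, witness u x v | exists x, witness v x u].

(** * Witnesses across a separation *)

Lemma sepC S A B : separation S A B -> separation S B A.
Proof.
case=> cov SA SB AB neA neB nA nB; split=> //.
- by move=> z; rewrite [(z \in B) || _]orbC.
- by move=> b a bB aA; rewrite dC AB.
Qed.

Lemma sep_BA S A B a b : separation S A B -> a \in A -> b \in B -> d b a = false.
Proof. by move=> sep aA bB; rewrite dC (sep_AB sep). Qed.

Lemma sep_neq S A B a b : separation S A B -> a \in A -> b \in B -> a != b.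
Proof.
by move=> sep aA bB; apply/eqP=> ab; have := sep_AB sep aA bB; rewrite ab dxx.
Qed.

Lemma sep_otherB S A B v : separation S A B -> exists2 b, b \in B & b != v.
Proof.
move=> sep; have [b bB] := sep_neB sep.
have [|nb] := eqVneq b v; last by exists b.
by move=> <-; have [c cB /andP[cb _]] := sep_nbrB sep bB; exists c.
Qed.

(** Some vertex of [B] other than [v] is out of reach of [x], so [u] is not in [A]; and [d u x]
    keeps [u] out of [B]. *)
Lemma witness_inA S A B u x v :
  separation S A B -> witness u x v -> x \in A -> u \in S.
Proof.
move=> sep [ux _ _ dom] xA.
case/or3P: (sep_cover sep u) => // uX.
  have [b bB bv] := sep_otherB v sep.
  by move/(_ _ bv): dom; rewrite !(sep_AB sep).
by move: ux; rewrite (sep_BA sep).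
Qed.

Lemma witness_in_cut S A B u x v :
  separation S A B -> witness u x v -> u \notin S -> x \in S.
Proof.
move=> sep wit; apply: contraNT => xS.
case/or3P: (sep_cover sep x) => xX; first by rewrite xX in xS.
  exact: witness_inA sep wit xX.
exact: witness_inA (sepC sep) wit xX.
Qed.

Lemma witness_A_dominates S A B u x v b :
  separation S A B -> witness u x v -> x \in A -> b \in B -> b != v -> d u b.
Proof.
move=> sep [_ _ _ dom] xA bB bv.
by have := dom _ bv; rewrite (sep_AB sep xA bB) orbF.
Qed.

Lemma critical_AB S A B a b : separation S A B -> a \in A -> b \in B ->
  [\/ covers a b, exists2 x, x \in S & witness a x b
    | exists2 x, x \in S & witness b x a].
Proof.
move=> sep aA bB; have /critical[] : ~~ d a b by rewrite (sep_AB sep).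
- by constructor 1.
- move=> [x wit]; constructor 2; exists x => //.
  exact: witness_in_cut sep wit (sep_SA sep aA).
- move=> [x wit]; constructor 3; exists x => //.
  exact: witness_in_cut sep wit (sep_SB sep bB).
Qed.

(** * The tournament on an independent set *)

Lemma independent_neq I u v :
  independent_for I -> u \in I -> v \in I -> u != v -> d u v = false.
Proof. by move=> ind uI vI /negbTE uv; rewrite ind. Qed.

Lemma third_point I u v : 2 < #|I| -> exists2 w, w \in I & (w != u) && (w != v).
Proof.
move=> I3; have : I :\: [set u; v] != set0.
  rewrite -subset0; apply/negP; rewrite subset0 setD_eq0 => /subset_leq_card.
  by rewrite cards2 => I2; have := leq_trans I3 I2; case: (u != v).
by case/set0Pn=> w; rewrite !inE negb_or => /andP[nw wI]; exists w.
Qed.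

(** Within [I], [u] dominates only itself, so [x] must dominate all the rest except [v]. Were [x] in
    [I], it would equal [u] and leave a third vertex undominated. *)
Lemma witness_independent I u x v : independent_for I -> 2 < #|I| ->
  u \in I -> v \in I -> witness u x v ->
  x \notin I /\ {in I, forall w, d x w = (w != v)}.
Proof.
move=> ind I3 uI vI [ux uv xv dom].
have [t tI /andP[tu tv]] := third_point u v I3.
have xI : x \notin I.
  apply/negP=> xI; move: ux; rewrite ind // => /eqP eux; subst x.
  by move/(_ _ tv): dom; rewrite orbb (independent_neq ind uI tI) // eq_sym.
split=> // w wI; have [->|wv] := eqVneq w v; first exact: negbTE.
have [->|wu] := eqVneq w u; first by rewrite dC.
by have := dom _ wv; rewrite (independent_neq ind uI wI) // eq_sym.
Qed.

Lemma critical_independent I u v : independent_for I -> 2 < #|I| ->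
  u \in I -> v \in I -> u != v ->
  (exists x, witness u x v) \/ (exists x, witness v x u).
Proof.
move=> ind I3 uI vI uv.
have [|cov| |] := @critical u v; first by rewrite (independent_neq ind).
- have [t tI /andP[tu tv]] := third_point u v I3.
  by have := cov t; rewrite !(independent_neq ind) // eq_sym.
- by left.
- by right.
Qed.

(* Every arc of the tournament on [I :\: S] has its witness in [S :\: I], and a
   witness determines the head of its arc.  All vertices but one having positive
   in-degree, [#|I :\: S| <= #|S :\: I|.+1]; equality makes witnesses and heads
   correspond bijectively. *)
Lemma pivot_exists S A B I : separation S A B -> independent_for I ->
  #|S| < #|I| -> 2 < #|I| -> exists a0, pivot S I a0.
Proof.
move=> sep ind SI I3.
(* The tail of the arc is dropped: [x] alone determines the head [v]. *)
pose misses x v := [&& x \in S, x \notin I & [forall w in I, d x w == (w != v)]].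
have missP x v : misses x v ->
    [/\ x \in S, x \notin I & {in I, forall w, d x w = (w != v)}].
  by case/and3P=> xS xI /forall_inP m; split=> // w /m/eqP.
have wit_miss u x v : u \in I -> u \notin S -> v \in I -> witness u x v ->
    misses x v.
  move=> uI uS vI wit; have [xI xd] := witness_independent ind I3 uI vI wit.
  apply/and3P; split=> //; first exact: witness_in_cut sep wit uS.
  by apply/forall_inP=> w wI; rewrite xd.
pose O := I :\: S; pose W := S :\: I.
pose H := [set v in O | [exists x, misses x v]].
(* The value [v] is a dummy: [f] matters only on [H], where some [x] exists. *)
pose f v := if [pick x | misses x v] is Some x then x else v.
have fP v : v \in H -> misses (f v) v.
  rewrite inE => /andP[_ /existsP ex]; rewrite /f.
  by case: pickP => // no; case: ex => x; rewrite no.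
have OP v : v \in O -> v \in I /\ v \notin S by rewrite !inE => /andP[].
have HO v : v \in H -> v \in O by rewrite inE => /andP[].
have finj : {in H &, injective f}.
  move=> u v uH vH efuv; have [uI _] := OP _ (HO _ uH).
  have [_ _ /(_ _ uI)] := missP _ _ (fP _ uH).
  have [_ _ /(_ _ uI)] := missP _ _ (fP _ vH).
  by rewrite efuv eqxx => -> /negbFE/eqP.
have fW : f @: H \subset W.
  apply/subsetP=> _ /imsetP[v vH ->]; have [xS xI _] := missP _ _ (fP _ vH).
  by rewrite !inE xS xI.
have cHW : #|H| <= #|W| by rewrite -(card_in_imset finj) subset_leq_card.
(* An arc between two such vertices would put its head in [H]. *)
have uniqO u v : u \in O -> v \in O -> u \notin H -> v \notin H -> u = v.
  move=> uO vO uH vH; apply/eqP/negPn/negP=> nuv.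
  have [[uI uS] [vI vS]] := (OP _ uO, OP _ vO).
  have [[x wit]|[x wit]] := critical_independent ind I3 uI vI nuv.
    by case/negP: vH; rewrite inE vO; apply/existsP; exists x; apply: wit_miss wit.
  by case/negP: uH; rewrite inE uO; apply/existsP; exists x; apply: wit_miss wit.
have cOH : #|O :\: H| <= 1.
  by apply/card_le1_eqP => u v /setDP[uO uH] /setDP[vO vH]; exact: uniqO.
have cWO : #|W| < #|O|.
  have := SI; rewrite -(cardsID I S) -(cardsID S I) setIC ltn_add2l.
  by rewrite /O /W.
have HsO : H \subset O by apply/subsetP.
have cO : #|O| = #|H| + #|O :\: H|.
  by rewrite -(cardsID H O) (setIidPr HsO).
have [a0] : exists a0, a0 \in O :\: H.
  apply/set0Pn; rewrite -card_gt0 lt0n; apply/negP=> /eqP c0.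
  by rewrite cO c0 addn0 ltnNge cHW in cWO.
case/setDP=> a0O a0H; have [a0I a0S] := OP _ a0O.
(* [#|W| < #|O| <= #|H| + 1] makes the injection [f] onto. *)
have fHW : f @: H = W.
  apply/eqP; rewrite eqEcard fW (card_in_imset finj) -ltnS.
  by apply: leq_trans cWO _; rewrite cO -addn1 leq_add2l.
have onto x : x \in S -> x \notin I -> exists2 v, v \in H & x = f v.
  by move=> xS xI; have : x \in W by [rewrite !inE xS xI]; rewrite -fHW => /imsetP.
have inj x y v : x \in S -> x \notin I -> y \in S -> y \notin I ->
    v \in I -> ~~ d x v -> ~~ d y v -> x = y.
  move=> xS xI yS yI vI.
  have [u uH ->] := onto x xS xI; have [u' uH' ->] := onto y yS yI.
  have [_ _ ->] // := missP _ _ (fP _ uH); have [_ _ ->] // := missP _ _ (fP _ uH').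
  by move=> /negPn/eqP <- /negPn/eqP <-.
have wit0 v : v \in I -> v \notin S -> v != a0 ->
    exists x, [/\ x \in S, x \notin I & witness a0 x v].
  move=> vI vS va; rewrite eq_sym in va.
  have [[x wit]|[x wit]] := critical_independent ind I3 a0I vI va.
    by have [xS xI _] := missP _ _ (wit_miss _ _ _ a0I a0S vI wit); exists x.
  case/negP: a0H; rewrite inE a0O; apply/existsP; exists x.
  exact: wit_miss vI vS a0I wit.
exists a0; split=> // x xS xI; have [v vH def_x] := onto x xS xI.
have [_ _ xd] := missP _ _ (fP _ vH); rewrite -def_x in xd.
have [vI vS] := OP _ (HO _ vH).
have va : v != a0 by apply: contraNneq a0H => <-.
exists v; split=> //; have [y [yS yI wit]] := wit0 v vI vS va.
rewrite (inj x y v) //; first by rewrite xd // negbK.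
by case: wit.
Qed.

(** * Position of an independent set relative to the cut *)

Lemma pivot_cut_dominates S I a0 s x :
  pivot S I a0 -> s \in I -> s \in S -> x \in S -> x \notin I -> d x s.
Proof.
move=> piv sI sS xS xI; have [v [_ vS _ _ xd]] := pivot_miss piv xS xI.
by rewrite xd //; apply: contraNneq vS => <-.
Qed.

Lemma pivot_miss_witness S I a0 x v : pivot S I a0 ->
  x \in S -> x \notin I -> v \in I -> ~~ d x v -> witness a0 x v.
Proof.
move=> piv xS xI vI xv; have [u [uI _ _ wit xd]] := pivot_miss piv xS xI.
by move: xv; rewrite xd // negbK => /eqP->.
Qed.

(** If [I] avoided [S], then [S] would dominate [B] outside [I], where [B] is the side without [a0].
    For [a0] and some [b] in [B] outside [I] this leaves only [covers a0 b], and then an edge from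
    [b] to [S] dominates everything. *)
Lemma independent_meets_cut S A B I : separation S A B -> independent_for I ->
  #|S| < #|I| -> 2 < #|I| -> exists2 s, s \in I & s \in S.
Proof.
move=> sep ind SI I3; have [|no] := boolP [exists s, (s \in I) && (s \in S)].
  by case/existsP=> s /andP[]; exists s.
have IS z : z \in I -> z \notin S.
  by move=> zI; apply: contra no => zS; apply/existsP; exists z; rewrite zI.
have SnI z : z \in S -> z \notin I by move=> zS; apply: contraL zS => /IS.
have [a0 piv] := pivot_exists sep ind SI I3.
have a0I := pivot_in piv.
wlog a0A : A B sep / a0 \in A => [th|].
  case/or3P: (sep_cover sep a0) => a0X; first by have := IS _ a0I; rewrite a0X.
    exact: th _ _ sep a0X.
  exact: th _ _ (sepC sep) a0X.
have [b bB bI] : exists2 b, b \in B & b \notin I.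
  have [b bB] := sep_neB sep; have [bI|] := boolP (b \in I); last by exists b.
  have [c cB /andP[cb bc]] := sep_nbrB sep bB; exists c => //.
  by apply/negP=> cI; move: bc; rewrite ind // eq_sym (negbTE cb).
have xb x c : x \in S -> c \in B -> c \notin I -> d x c.
  move=> xS cB cI; have [v [vI _ _ [_ _ _ dom] _]] := pivot_miss piv xS (SnI _ xS).
  have cv : c != v by apply: contraNneq cI => ->.
  by have := dom _ cv; rewrite (sep_AB sep).
have [cov|[x xS [_ _ nxb _]]|[x xS [_ _ nxa _]]] := critical_AB sep a0A bB.
- have bB' c : c \in B -> d b c.
    by move=> cB; have := cov c; rewrite (sep_AB sep a0A cB).
  have IB v : v \in I -> v != a0 -> v \in B.
    move=> vI va; case/or3P: (sep_cover sep v) => // vX.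
      by have := IS _ vI; rewrite vX.
    have := cov v; rewrite (sep_BA sep vX bB) orbF ind // eq_sym.
    by rewrite (negbTE va).
  have [a1 a1I /andP[a1a _]] := third_point a0 a0 I3.
  have a1B := IB _ a1I a1a.
  have [x [xS xI wit]] := pivot_witness piv a1I (IS _ a1I) a1a.
  have [_ _ nxa1 _] := wit.
  (* For the pair [a], [a1]: [a2] rules out covering, a witness missing [a1] must be [x] itself, and
     one missing [a] would also miss [a1], to which it is adjacent. *)
  have xA a : a \in A -> d x a.
    move=> aA.
    have [cov'|[y yS [ay _ nya1 _]]|[y yS [a1y _ nya dom]]] :=
      critical_AB sep aA a1B.
    + have [a2 a2I /andP[a2a1 a2a0]] := third_point a1 a0 I3.
      have := cov' a2; rewrite (sep_AB sep aA (IB _ a2I a2a0)) ind // eq_sym.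
      by rewrite (negbTE a2a1).
    + by rewrite (pivot_inj piv xS xI yS (SnI _ yS) a1I) // dC.
    + have [v [vI vS va _ yd]] := pivot_miss piv yS (SnI _ yS).
      have vB := IB _ vI va.
      have va' : v != a by rewrite eq_sym (sep_neq sep).
      have := dom _ va'; rewrite yd // eqxx orbF ind // => /eqP ea1v.
      by move: a1y; rewrite dC yd // ea1v eqxx.
  have [z nbz nxz] := no_dominating_edge (xb _ _ xS bB bI).
  case/or3P: (sep_cover sep z) => zX.
  + by rewrite dC xb in nxz.
  + by rewrite xA in nbz.
  + by rewrite bB' in nxz.
- by rewrite xb in nxb.
- have [v [vI _ va _ xd]] := pivot_miss piv xS (SnI _ xS).
  by rewrite xd // eq_sym va in nxa.
Qed.

(* For [b] in [B], neither [y] nor [b] dominates [a0], so the pair [y], [b] needs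
   a witness in [S] dominating all of [I :&: A], and there is none. *)
Lemma no_witness_on_full_side S A B I a0 s y : separation S A B ->
  independent_for I -> 2 < #|I| -> pivot S I a0 ->
  (forall v, v \in I -> v \notin B) ->
  (forall x b, x \in S -> b \in B -> d x b) ->
  s \in I -> y \in A -> witness s y a0 -> False.
Proof.
move=> sep ind I3 piv InB SB sI yA wit.
have a0I := pivot_in piv; have a0S := pivot_out piv.
have IA v : v \in I -> v \notin S -> v \in A.
  move=> vI vS; case/or3P: (sep_cover sep v) => // vX; first by rewrite vX in vS.
  by have := InB _ vI; rewrite vX.
have a0A := IA _ a0I a0S; have [b bB] := sep_neB sep.
have [yI _] := witness_independent ind I3 sI a0I wit.
have [_ _ nya0 _] := wit.
have ya0 : a0 != y by apply: contraNneq yI => <-.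
have [cov|[x xS [_ _ nxb _]]|[x xS [_ _ nxy dom]]] := critical_AB sep yA bB.
- by have := cov a0; rewrite (negbTE nya0) (sep_BA sep).
- by rewrite SB in nxb.
- have [xI|xI] := boolP (x \in I).
    have := dom _ ya0; rewrite (sep_BA sep) //= ind // => /eqP exa0.
    by rewrite -exa0 xS in a0S.
  have [v [vI vS _ _ xd]] := pivot_miss piv xS xI.
  have vy : v != y by apply: contraNneq yI => <-.
  by have := dom _ vy; rewrite (sep_BA sep (IA _ vI vS) bB) xd // eqxx.
Qed.

(** An arc from [v] to [s] would have its witness in [S :\: I], whose vertices all dominate [s]. *)
Lemma pivot_source S A B I a0 s v : separation S A B ->
  independent_for I -> 2 < #|I| -> pivot S I a0 ->
  s \in I -> s \in S -> v \in I -> v \notin S -> exists x, witness s x v.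
Proof.
move=> sep ind I3 piv sI sS vI vS.
have sv : s != v by apply: contraNneq vS => <-.
have [//|[x wit]] := critical_independent ind I3 sI vI sv.
have [xI xd] := witness_independent ind I3 vI sI wit.
have := pivot_cut_dominates piv sI sS (witness_in_cut sep wit vS) xI.
by rewrite xd // eqxx.
Qed.

(** A vertex of [S :\: I] misses exactly one vertex of [I], and never [a0]. *)
Lemma pivot_source_out S A B I a0 s : separation S A B ->
  independent_for I -> 2 < #|I| -> pivot S I a0 ->
  s \in I -> s \in S -> exists2 x, x \notin S & witness s x a0.
Proof.
move=> sep ind I3 piv sI sS; have a0I := pivot_in piv.
have [x wit] := pivot_source sep ind I3 piv sI sS a0I (pivot_out piv).
exists x => //; apply/negP=> xS.
have [xI xd] := witness_independent ind I3 sI a0I wit.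
have [v [_ _ va _ xd']] := pivot_miss piv xS xI.
by have := xd _ a0I; rewrite xd' // eqxx eq_sym va.
Qed.

Lemma witness_A_avoids S A B I s x v w : separation S A B ->
  independent_for I -> 2 < #|I| -> s \in I -> v \in I -> witness s x v ->
  x \in A -> w \in I -> w \in B -> w = v.
Proof.
move=> sep ind I3 sI vI wit xA wI wB; apply/eqP.
have [_ xd] := witness_independent ind I3 sI vI wit.
by apply: negbFE; rewrite -(xd _ wI) (sep_AB sep).
Qed.

(** Otherwise [S] lies in [I], and each [s] in [S] dominates everything outside [S] but [a0]. With a
    neighbour of [a0] on its own side, [s] then forms a dominating edge. *)
Lemma pivot_not_alone S A B I a0 : separation S A B ->
  independent_for I -> 2 < #|I| -> pivot S I a0 ->
  exists2 v, v \in I & (v \notin S) && (v != a0).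
Proof.
move=> sep ind I3 piv; apply/exists_inP; apply: contraT => no.
have O0 v : v \in I -> v \notin S -> v = a0.
  move=> vI vS; apply/eqP/negPn/negP=> va.
  by case/negP: no; apply/exists_inP; exists v; rewrite // vS.
have a0I := pivot_in piv; have a0S := pivot_out piv.
have SI x : x \in S -> x \in I.
  move=> xS; apply: contraT => xI.
  have [v [vI vS va _ _]] := pivot_miss piv xS xI.
  by rewrite (O0 _ vI vS) eqxx in va.
wlog a0A : A B sep / a0 \in A => [th|].
  case/or3P: (sep_cover sep a0) => a0X; first by rewrite a0X in a0S.
    exact: th _ _ sep a0X.
  exact: th _ _ (sepC sep) a0X.
have Sa0 x : x \in S -> d x a0 = false.
  move=> xS; apply: (independent_neq ind) => //; first exact: SI.
  by apply: contraNneq a0S => <-.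
have SB x b : x \in S -> b \in B -> d x b.
  move=> xS bB.
  have [cov|[y yS [a0y _ _ _]]|[y yS [bY _ _ dom]]] := critical_AB sep a0A bB.
  - by have := cov x; rewrite dC Sa0 // dC.
  - by rewrite dC Sa0 in a0y.
  - have [->|xy] := eqVneq x y; first by rewrite dC.
    have xa0 : x != a0 by apply: contraNneq a0S => <-.
    have := dom _ xa0; rewrite (independent_neq ind (SI _ yS) (SI _ xS)) ?orbF.
      by rewrite dC.
    by rewrite eq_sym.
have InB v : v \in I -> v \notin B.
  move=> vI; apply/negP=> vB; have := sep_neq sep a0A vB.
  by rewrite (O0 v) ?eqxx // (sep_SB sep).
have SA x a : x \in S -> a \in A -> a != a0 -> d x a.
  move=> xS aA aa0.
  have [y yS wit] := pivot_source_out sep ind I3 piv (SI _ xS) xS.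
  case/or3P: (sep_cover sep y) => yX; first by rewrite yX in yS.
    by case: (no_witness_on_full_side sep ind I3 piv InB SB (SI _ xS) yX wit).
  exact: witness_A_dominates (sepC sep) wit yX aA aa0.
have [z zA /andP[za0 a0z]] := sep_nbrA sep a0A.
have [s sI /andP[sa0 _]] := third_point a0 a0 I3.
have sS : s \in S by apply: contraT => sS; rewrite (O0 _ sI sS) eqxx in sa0.
have [t nst nzt] := no_dominating_edge (SA s z sS zA za0).
case/or3P: (sep_cover sep t) => tX.
- by rewrite dC SA in nzt.
- have [ta0|ta0] := eqVneq t a0; first by rewrite ta0 dC a0z in nzt.
  by rewrite SA in nst.
- by rewrite SB in nst.
Qed.

Lemma independent_two_cut S A B I : separation S A B -> independent_for I ->
  #|S| < #|I| -> 2 < #|I| ->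
  exists s x a0 a1, two_cut S A B I s x a0 a1 \/ two_cut S B A I s x a0 a1.
Proof.
move=> sep ind SI I3.
have [s sI sS] := independent_meets_cut sep ind SI I3.
have [a0 piv] := pivot_exists sep ind SI I3.
have [a1 a1I /andP[a1S a1a0]] := pivot_not_alone sep ind I3 piv.
have a0I := pivot_in piv; have a0S := pivot_out piv.
have [y yS wit] := pivot_source_out sep ind I3 piv sI sS.
(* The side of the witness [y] is named [A]; hence the two alternatives in the conclusion. *)
wlog yA : A B sep / y \in A => [th|].
  case/or3P: (sep_cover sep y) => yX; first by rewrite yX in yS.
    exact: th _ _ sep yX.
  have [s' [x' [b0 [b1 tc]]]] := th _ _ (sepC sep) yX.
  by exists s', x', b0, b1; case: tc; [right|left].
have IB v : v \in I -> v \in B -> v = a0.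
  exact: witness_A_avoids sep ind I3 sI a0I wit yA.
have OA v : v \in I -> v \notin S -> v != a0 -> v \in A.
  move=> vI vS va; case/or3P: (sep_cover sep v) => // vX; first by rewrite vX in vS.
  by rewrite (IB v) ?eqxx in va.
have a1A := OA _ a1I a1S a1a0.
(* Were [a0] in [A], [I] would avoid [B] and [S] would dominate [B], against
   [no_witness_on_full_side]. *)
case/or3P: (sep_cover sep a0) => a0X; first by rewrite a0X in a0S.
  have InB v : v \in I -> v \notin B.
    move=> vI; apply/negP=> vB; have := sep_neq sep a0X vB.
    by rewrite (IB v) ?eqxx.
  suff SB : forall x b, x \in S -> b \in B -> d x b.
    by case: (no_witness_on_full_side sep ind I3 piv InB SB sI yA wit).
  move=> x b xS bB.
  have [xI|xI] := boolP (x \in I).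
    have [z zS witz] := pivot_source_out sep ind I3 piv xI xS.
    case/or3P: (sep_cover sep z) => zX; first by rewrite zX in zS.
      have ba0 : b != a0 by rewrite eq_sym (sep_neq sep).
      exact: witness_A_dominates sep witz zX bB ba0.
    have := witness_A_avoids (sepC sep) ind I3 xI a0I witz zX a1I a1A.
    by move=> e1; rewrite e1 eqxx in a1a0.
  have [v [vI vS va [_ _ _ dom] _]] := pivot_miss piv xS xI.
  have bv : b != v by rewrite eq_sym (sep_neq sep (OA _ vI vS va)).
  by have := dom _ bv; rewrite (sep_AB sep).
(* An arc inside [I :&: S] has no place for its witness: in [S] it would dominate the head, in [A]
   it would miss [a0] too, in [B] it would miss [a1] too. *)
have IS t : t \in I -> t \in S -> t = s.
  have one u v z : u \in I -> v \in I -> u \in S -> v \in S -> witness u z v -> False.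
    move=> uI vI uS vS witz.
    have [zI zd] := witness_independent ind I3 uI vI witz.
    case/or3P: (sep_cover sep z) => zX.
    - have := pivot_cut_dominates piv vI vS zX zI.
      by rewrite zd // eqxx.
    - have e0 := witness_A_avoids sep ind I3 uI vI witz zX a0I a0X.
      by rewrite e0 vS in a0S.
    - have e1 := witness_A_avoids (sepC sep) ind I3 uI vI witz zX a1I a1A.
      by rewrite e1 vS in a1S.
  move=> tI tS; apply/eqP/negPn/negP=> ts.
  have [[z]|[z]] := critical_independent ind I3 tI sI ts; first exact: one.
  exact: one.
have xA x v a : x \in S -> x \notin I -> v \in I -> ~~ d x v ->
    a \in A -> a != v -> d x a.
  move=> xS xI vI xv aA av.
  have [_ _ _ dom] := pivot_miss_witness piv xS xI vI xv.
  by have := dom _ av; rewrite (sep_BA sep).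
(* Otherwise [x] and a neighbour in [A] of the vertex [v] missed by [x] form a dominating edge. *)
have incomplete x : x \in S -> x \notin I -> exists2 b, b \in B & ~~ d x b.
  move=> xS xI; apply/exists_inP; apply: contraT => no.
  have xB b : b \in B -> d x b.
    by move=> bB; apply: contraT => nb; case/exists_inP: no; exists b.
  have [v [vI vS va _ xd]] := pivot_miss piv xS xI.
  have xv : ~~ d x v by rewrite xd // eqxx.
  have [z zA /andP[zv vz]] := sep_nbrA sep (OA _ vI vS va).
  have zI : z \notin I.
    by apply/negP=> zI; rewrite ind // eq_sym (negbTE zv) in vz.
  have Wz t : t \in S -> t \notin I -> d t z.
    move=> tS tI; have [u [uI _ _ _ td]] := pivot_miss piv tS tI.
    apply: (xA t u) => //; first by rewrite td // eqxx.
    by apply: contraNneq zI => ->.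
  have [t nxt nzt] := no_dominating_edge (Wz x xS xI).
  case/or3P: (sep_cover sep t) => tX.
  - have [tI|tI] := boolP (t \in I).
      by rewrite (pivot_cut_dominates piv tI tX xS xI) in nxt.
    by rewrite dC Wz in nzt.
  - have [tv|tv] := eqVneq t v; first by rewrite tv dC vz in nzt.
    by rewrite (xA x v) in nxt.
  - by rewrite xB in nxt.
have [x [xS xI [a0x _ nxa1 _]]] := pivot_witness piv a1I a1S a1a0.
(* A further [v] would let criticality of [a1] and [b] force [d x b], against the choice of [b]. *)
have O2 v : v \in I -> v \notin S -> v != a0 -> v = a1.
  move=> vI vS va; apply/eqP/negPn/negP=> va1.
  have vA := OA _ vI vS va.
  have [b bB /negP[]] := incomplete x xS xI.
  have [cov|[z zS [a1z _ _ dom]]|[z zS [bz _ nza1 dom]]] :=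
    critical_AB sep a1A bB.
  - have := cov v; rewrite (sep_BA sep vA bB) orbF ind // eq_sym.
    by rewrite (negbTE va1).
  - have zI : z \notin I.
      apply/negP=> zI; move: a1z; rewrite ind // => /eqP e1.
      by rewrite e1 zS in a1S.
    have [u [uI uS ua _ zd]] := pivot_miss piv zS zI.
    have ub : u != b by rewrite (sep_neq sep (OA _ uI uS ua)).
    have := dom _ ub; rewrite zd // eqxx orbF ind // => /eqP e1.
    by move: a1z; rewrite dC zd // e1 eqxx.
  - have zv : d z v by have := dom _ va1; rewrite (sep_BA sep).
    have zI : z \notin I.
      apply/negP=> zI; move: zv; rewrite ind // => /eqP e1.
      by rewrite -e1 zS in vS.
    by rewrite (pivot_inj piv xS xI zS zI a1I) // dC.
exists s, x, a0, a1; left; split=> //.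
- apply/setP=> z; rewrite !inE; apply/idP/idP=> [zI|].
    have [/IS->//|zS] := boolP (z \in S); first by rewrite eqxx.
    have [//|za] := eqVneq z a0; first by rewrite orbT.
    by rewrite (O2 z) // eqxx orbT.
  by case/orP=> [/orP[]|] /eqP->.
- apply/setP=> z; rewrite !inE; apply/idP/idP=> [zS|]; last by case/orP=> /eqP->.
  have [/IS->//|zI] := boolP (z \in I); first by rewrite eqxx.
  have [v [vI vS va _ zd]] := pivot_miss piv zS zI.
  rewrite (pivot_inj piv zS zI xS xI a1I) ?eqxx ?orbT //.
  by rewrite zd // (O2 v) ?eqxx.
- by apply: contraNneq xI => <-.
- exact: pivot_cut_dominates piv sI sS xS xI.
- by rewrite dC.
- by move=> a aA aa1; apply: (xA x a1).
- move=> b bB ba0; exact: witness_A_dominates sep wit yA bB ba0.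
- exact: incomplete.
Qed.

(** * Adjacencies around a cut of two vertices *)

Lemma independent_triple a b c : ~~ d a b -> ~~ d a c -> ~~ d b c ->
  independent_for [set a; b; c] /\ #|[set a; b; c]| = 3.
Proof.
move=> ab ac bc.
have neq u v : ~~ d u v -> u != v by apply: contraNneq => ->.
split; last by rewrite -setUA cardsU1 !inE negb_or cards2 !neq.
have ndE u v : ~~ d u v -> d u v = (u == v).
  by move=> nd; rewrite (negbTE nd) (negbTE (neq _ _ nd)).
move=> u v; rewrite !inE -!orbA.
by move=> /or3P[]/eqP-> /or3P[]/eqP->;
  rewrite ?dxx ?eqxx //; apply: ndE => //; rewrite dC.
Qed.

(* The roles of [s] and [x] are exchanged by applying [independent_two_cut] to the
   independent set [[set x; a1; u]], where [u] is missed by [x]. *)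
Lemma two_cut_complete S A B I s x a0 a1 : separation S A B ->
  two_cut S A B I s x a0 a1 ->
  [/\ exists u, [/\ u \in B, ~~ d x u & forall b, b \in B -> b != u -> d x b],
      forall a, a \in A -> a != a1 -> d s a,
      {in A &, forall a a', d a a'} & {in B &, forall b b', d b b'}].
Proof.
move=> sep [_ defS sx a0B a1A xs xa0 xa1 _ sB [u uB xu]].
have S2 : #|S| = 2 by rewrite defS cards2 sx.
have sS : s \in S by rewrite defS !inE eqxx.
have xS : x \in S by rewrite defS !inE eqxx orbT.
have AnS z : z \in A -> (z \in S) = false by move/(sep_SA sep)/negbTE.
have BnS z : z \in B -> (z \in S) = false by move/(sep_SB sep)/negbTE.
(* Otherwise [p], [q], [r] form an independent triple disjoint from the cut, against
   [independent_meets_cut]. *)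
have avoid p q r : p \in A -> r \in B -> q \in A \/ q \in B ->
    ~~ d p q -> ~~ d q r -> False.
  move=> pA rB qAB pq qr; have pr : ~~ d p r by rewrite (sep_AB sep).
  have [ind c3] := independent_triple pq pr qr.
  have [t] : exists2 t, t \in [set p; q; r] & t \in S.
    by apply: independent_meets_cut sep ind _ _; rewrite c3 ?S2.
  rewrite !inE -orbA => /or3P[]/eqP->; first by rewrite AnS.
    by case: qAB => [/AnS|/BnS] ->.
  by rewrite BnS.
have cliqueA : {in A &, forall a a', d a a'}.
  move=> a a' aA a'A; apply: contraT => naa'.
  by case: (avoid a a' a0 aA a0B (or_introl a'A) naa'); rewrite (sep_AB sep).
have cliqueB : {in B &, forall b b', d b b'}.
  move=> b b' bB b'B; apply: contraT => nbb'.
  have a1b : ~~ d a1 b by rewrite (sep_AB sep).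
  by case: (avoid a1 b b' a1A b'B (or_intror bB) a1b nbb').
have ua0 : u != a0 by apply: contraNneq xu => ->.
have a1u : ~~ d a1 u by rewrite (sep_AB sep).
have [ind c3] := independent_triple xa1 xu a1u.
have SI : #|S| < #|[set x; a1; u]| by rewrite c3 S2.
have [s' [x' [b0 [b1 tc]]]] := independent_two_cut sep ind SI (eq_leq (esym c3)).
(* The triple meets [S] in [x] alone, so [s'] is [x] and [x'] is [s]. As [s] dominates [u] but [x']
   misses [b1], [b1] must be [a1]. *)
have core A' B' : separation S A' B' ->
    two_cut S A' B' [set x; a1; u] s' x' b0 b1 -> [/\ x' = s, s' = x, b1 = a1 & b0 = u].
  move=> sep' [defI' defS' sx' b0B b1A _ _ xb1 _ _ _].
  have: s' \in [set x; a1; u] by rewrite defI' !inE eqxx.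
  have s'S : s' \in S by rewrite defS' !inE eqxx.
  rewrite !inE -orbA => /or3P[]/eqP es; last 2 first.
  - by rewrite es AnS in s'S.
  - by rewrite es BnS in s'S.
  have: x' \in S by rewrite defS' !inE eqxx orbT.
  rewrite defS !inE -es eq_sym [x' == s']eq_sym (negbTE sx') orbF => /eqP ex.
  have b1S := sep_SA sep' b1A; have b0S := sep_SB sep' b0B.
  have: b1 \in [set x; a1; u] by rewrite defI' !inE eqxx !orbT.
  rewrite !inE -orbA => /or3P[]/eqP e1; first by rewrite e1 xS in b1S.
    have: b0 \in [set x; a1; u] by rewrite defI' !inE eqxx !orbT.
    rewrite !inE -orbA => /or3P[]/eqP e0; first by rewrite e0 xS in b0S.
      by have := sep_neq sep' b1A b0B; rewrite e1 e0 eqxx.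
    by split.
  by rewrite e1 -ex sB in xb1.
case: tc => tc.
  have [ex es e1 e0] := core _ _ sep tc; rewrite {}ex {}es {}e1 {}e0 in tc.
  split=> //; last exact: tc_xA tc.
  by exists u; split=> //; exact: tc_sB tc.
(* With the sides exchanged, [a1] would lie in [B]. *)
have [_ _ e1 _] := core _ _ (sepC sep) tc.
by have := sep_neq sep a1A (tc_a1 tc); rewrite e1 eqxx.
Qed.

(** A cut vertex [c] misses some [z], say in [A]; criticality of [z] against [B] makes [c] dominate
    [B]. For a neighbour [a] of [c] in [A] and any [b] in [B], covering would make [a], [c] a
    dominating edge, and a witness would be [c], which misses neither. *)
Lemma cut_gt1 S A B : separation S A B ->
  (forall X : {set T}, (exists a, a \in X) -> (exists b, b \notin X) ->
     exists a c, [/\ a \in X, c \notin X & d a c]) -> 1 < #|S|.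
Proof.
move=> sep conn; rewrite ltnNge; apply/negP=> /card_le1_eqP S1.
have edge A' B' : separation S A' B' -> exists a c, [/\ a \in A', c \in S & d a c].
  move=> sep'; have [b bB] := sep_neB sep'.
  have [||a [c [aA cA ac]]] := conn A'; first exact: sep_neA sep'.
    exists b; apply/negP=> bA; have := sep_neq sep' bA bB.
    by rewrite eqxx.
  exists a, c; split=> //; case/or3P: (sep_cover sep' c) => // cX.
    by rewrite cX in cA.
  by rewrite (sep_AB sep') in ac.
have [_ [c [_ cS _]]] := edge _ _ sep.
have [z ncz _] := no_dominating_edge (dxx c).
wlog zA : A B sep / z \in A => [th|].
  case/or3P: (sep_cover sep z) => zX; first by rewrite (S1 c z) ?dxx in ncz.
    exact: th _ _ sep zX.
  exact: th _ _ (sepC sep) zX.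
have cB b : b \in B -> d c b.
  move=> bB; have [cov|[x xS [zx _ _ _]]|[x xS [bx _ _ _]]] := critical_AB sep zA bB.
  - by have := cov c; rewrite dC (negbTE ncz) dC.
  - by rewrite (S1 c x) // dC (negbTE ncz) in zx.
  - by rewrite -(S1 c x) // dC.
have [a [c' [aA c'S ac]]] := edge _ _ sep; rewrite {}(S1 c c') // in ac.
have [b bB] := sep_neB sep.
have [cov|[x xS [_ _ nxb _]]|[x xS [_ _ nxa _]]] := critical_AB sep aA bB.
- have [t nat nct] := no_dominating_edge ac.
  case/or3P: (sep_cover sep t) => tX; first by rewrite (S1 c t) ?dxx in nct.
    by have := cov t; rewrite (negbTE nat) (sep_BA sep).
  by rewrite cB in nct.
- by rewrite (S1 c x) // cB in nxb.
- by rewrite (S1 c x) // dC ac in nxa.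
Qed.

End Domination.

(** * Minima with a default value *)

Section BigMin.

Variables (I : finType) (P : pred I) (F : I -> nat) (m : nat).

Lemma bigminn_geP k :
  reflect (k <= m /\ forall i, P i -> k <= F i) (k <= \big[minn/m]_(i | P i) F i).
Proof. by rewrite -minEnat; exact: (@Order.TotalTheory.bigmin_geP _ nat I m k P F). Qed.

Lemma bigminn_default : \big[minn/m]_(i | P i) F i <= m.
Proof. by have /bigminn_geP[] := leqnn (\big[minn/m]_(i | P i) F i). Qed.

Lemma bigminn_inf i : P i -> \big[minn/m]_(i | P i) F i <= F i.
Proof.
by have /bigminn_geP[_ h] := leqnn (\big[minn/m]_(i | P i) F i); exact: h.
Qed.

(** The bound [k <= m] excludes the default value. *)
Lemma bigminn_attained k : \big[minn/m]_(i | P i) F i < k -> k <= m ->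
  exists2 i, P i & F i < k.
Proof.
rewrite ltnNge => /bigminn_geP lt km; apply/exists_inP; apply: contraT => no.
case: lt; split=> // i Pi; rewrite leqNgt; apply: contra no => Fi.
by apply/exists_inP; exists i.
Qed.

End BigMin.

(** * From graph parameters to domination, and back to the explicit class *)

Section Graphs.

Variables (T : finType) (e : rel T).
Hypotheses (e_sym : symmetric e) (e_irr : irreflexive e).

Definition closed_adj : rel T := fun u v => (u == v) || e u v.

Lemma closed_adj_refl : reflexive closed_adj.
Proof. by move=> u; rewrite /closed_adj eqxx. Qed.

Lemma closed_adj_sym : symmetric closed_adj.
Proof. by move=> u v; rewrite /closed_adj eq_sym e_sym. Qed.

Lemma adjE u v : e u v = (u != v) && closed_adj u v.
Proof. by rewrite /closed_adj; case: eqVneq => // ->; rewrite e_irr. Qed.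

Lemma degree_lt u : degree e u < #|T|.
Proof.
rewrite /degree -cardsT; apply: proper_card; rewrite properE subsetT.
by apply/subsetPn; exists u; rewrite !inE ?e_irr.
Qed.

Lemma connected_dominating_pair (r : rel T) u x : r u x -> r x u ->
  (forall z, [|| z == u, z == x, r z u | r z x]) ->
  connected_dominating r [set u; x].
Proof.
move=> ux xu dom; apply/andP; split.
  apply/forallP=> z; have := dom z; rewrite !inE -orbA.
  case/or4P=> [->|->|zu|zx]; rewrite ?orbT //.
    by rewrite orbA; apply/orP; right; apply/exists_inP; exists u; rewrite ?inE ?eqxx.
  by rewrite orbA; apply/orP; right; apply/exists_inP; exists x; rewrite ?inE ?eqxx ?orbT.
apply/forall_inP=> a; rewrite !inE => aD; apply/forall_inP=> b; rewrite !inE => bD.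
by case/orP: aD => /eqP->; case/orP: bD => /eqP->; rewrite ?connect0 //;
  apply: connect1; rewrite /induced /= !inE !eqxx ?orbT.
Qed.

Lemma gamma_c_no_dominating_edge : gamma_c e = 3 ->
  forall u x, closed_adj u x -> exists2 z, ~~ closed_adj u z & ~~ closed_adj x z.
Proof.
move=> g3.
have T3 : 3 <= #|T| by rewrite -g3; exact: bigminn_default.
have key u x : e u x -> exists2 z, ~~ closed_adj u z & ~~ closed_adj x z.
  move=> ux; apply/exists_inP; apply: contraT => no.
  suff /(bigminn_inf (fun D : {set T} => #|D|) #|T|) :
      connected_dominating e [set u; x].
    by rewrite -/(gamma_c e) g3 cards2; case: (u != x).
  apply: connected_dominating_pair => //; first by rewrite e_sym.
  move=> z; apply: contraNT no; rewrite !negb_or => /and4P[zu zx nzu nzx].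
  apply/exists_inP; exists z; rewrite /closed_adj negb_or ?(eq_sym _ z) e_sym.
    by rewrite zu.
  by rewrite zx.
(* If [u = x], a neighbour of [u] supplies an edge; an isolated [u] leaves any other vertex
   undominated. *)
move=> u x /orP[/eqP <-|]; last exact: key.
have [y uy|no] := pickP (e u).
  by have [z nu _] := key _ _ uy; exists z.
have [y] : exists y, y \in [set~ u].
  by apply/set0Pn; rewrite -card_gt0 cardsC1; case: #|T| T3 => [|[]].
by rewrite !inE => yu; exists y; rewrite /closed_adj negb_or eq_sym yu no.
Qed.

Lemma connected_in_pair (r : rel T) x y : connected_in r [set x; y] -> x != y -> r x y.
Proof.
move=> /forall_inP/(_ x); rewrite !inE eqxx => /(_ isT)/forall_inP/(_ y).
rewrite !inE eqxx orbT => /(_ isT) /connectP[p].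
elim: p => [|z p IH] /= ; first by move=> _ ->; rewrite eqxx.
by case/andP=> /and3P[_]; rewrite !inE => /orP[]/eqP->.
Qed.

(** The alternatives correspond to a connected dominating set [D] of G + uv, of size at most two,
    containing both of [u] and [v], only [u], or only [v]. Containing neither, [D] would already
    work in G. *)
Lemma critical_closed_adj : critical3 e -> forall u v, ~~ closed_adj u v ->
  [\/ covers closed_adj u v, exists x, witness closed_adj u x v
    | exists x, witness closed_adj v x u].
Proof.
move=> [g3 crit] u v; rewrite /closed_adj negb_or => /andP[uv nuv].
have T3 : 3 <= #|T| by rewrite -g3; exact: bigminn_default.
have no2 := gamma_c_no_dominating_edge g3.
have dC := closed_adj_sym; have dxx := closed_adj_refl.
have [D /andP[dom conn] D3] := bigminn_attained (crit u v uv nuv) T3.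
pose new y z := (y = u /\ z = v) \/ (y = v /\ z = u).
have newE y z : add_edge e u v y z -> e y z \/ new y z.
  case/or3P=> [->|/andP[/eqP-> /eqP->]|/andP[/eqP-> /eqP->]]; first by left.
    by right; left.
  by right; right.
have {}dom z : exists2 y, y \in D & closed_adj y z \/ new z y.
  case/orP: (forallP dom z) => [zD|/exists_inP[y yD zy]].
    by exists z => //; left.
  exists y => //; case: (newE _ _ zy) => [ezy|]; last by right.
  by left; rewrite dC /closed_adj ezy orbT.
have [p [q defD]] : exists p q, D = [set p; q].
  have [y yD _] := dom u; have: 0 < #|D| by apply/card_gt0P; exists y.
  move: D3; rewrite ltnS leq_eqVlt ltnS => /orP[/cards2P[p [q [_ ->]]]|D1 D0].
    by exists p, q.
  have /cards1P[p ->] : #|D| == 1 by rewrite eqn_leq D1.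
  by exists p, p; rewrite setUid.
have other y : y \in D -> exists2 x, D = [set y; x] & closed_adj y x \/ new y x.
  move=> yD; have [x defDy] : exists x, D = [set y; x].
    move: yD; rewrite defD !inE => /orP[]/eqP->; first by exists q.
    by exists p; rewrite setUC.
  exists x => //; have [->|yx] := eqVneq y x; first by left.
  rewrite defDy in conn; case: (newE _ _ (connected_in_pair conn yx)) => [eyx|].
    by left; rewrite /closed_adj eyx orbT.
  by right.
(* As [w] is outside [D], the added edge serves only to dominate [w]; [no2] shows that it is indeed
   needed there. *)
have half y w : (y = u /\ w = v) \/ (y = v /\ w = u) -> y \in D -> w \notin D ->
    exists x, witness closed_adj y x w.
  move=> yw yD wD; have [x defDy yx] := other y yD.
  have xw : x != w by apply: contraNneq wD => <-; rewrite defDy !inE eqxx orbT.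
  have {}yx : closed_adj y x.
    case: yx => // -[] [ey ex]; case: yw => -[ey' ew].
    - by rewrite ex ew eqxx in xw.
    - by rewrite -ey ey' eqxx in uv.
    - by rewrite -ey ey' eqxx in uv.
    - by rewrite ex ew eqxx in xw.
  have undom z : closed_adj y z || closed_adj x z || (z == w).
    have [t] := dom z; rewrite defDy !inE => /orP[]/eqP et [tz|zt].
    - by rewrite -et tz.
    - by case: yw zt => -[-> ->] [] [-> _]; rewrite ?dxx ?eqxx ?orbT.
    - by rewrite -et tz orbT.
    - by case: yw zt => -[-> ->] [] [-> _]; rewrite ?dxx ?eqxx ?orbT.
  have [z nyz nxz] := no2 _ _ yx.
  have := undom z; rewrite (negbTE nyz) (negbTE nxz) => /eqP ezw.
  exists x; rewrite -ezw; split=> // t tw.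
  by have := undom t; rewrite -ezw (negbTE tw) orbF.
have [uD|uD] := boolP (u \in D); have [vD|vD] := boolP (v \in D).
- constructor 1 => z.
  have DE t : t \in D -> (t = u) \/ (t = v).
    have [x defDu _] := other u uD; move: vD; rewrite defDu !inE.
    rewrite eq_sym (negbTE uv) /= => /eqP->.
    by case/orP=> /eqP; [left|right].
  have [t /DE tD [tz|]] := dom z; last first.
    by case=> -[-> _]; apply/orP; [left|right]; exact: dxx.
  by case: tD tz => -> tz; apply/orP; [left|right].
- by constructor 2; apply: half => //; left.
- by constructor 3; apply: half => //; right.
- have pD : p \in D by rewrite defD !inE eqxx.
  have [x defDp px] := other p pD.
  have {}px : closed_adj p x.
    case: px => // -[][ep _]; first by rewrite -ep pD in uD.
    by rewrite -ep pD in vD.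
  have [z npz nxz] := no2 _ _ px; have [t tD [tz|]] := dom z.
    move: tD tz; rewrite defDp !inE => /orP[]/eqP->; last by rewrite (negbTE nxz).
    by rewrite (negbTE npz).
  by case=> -[_ et]; [rewrite -et tD in vD | rewrite -et tD in uD].
Qed.

Lemma connected_graph_escape : connected_graph e -> forall X : {set T},
  (exists a, a \in X) -> (exists b, b \notin X) ->
  exists a c, [/\ a \in X, c \notin X & closed_adj a c].
Proof.
move=> conn X [a aX] [b bX].
have [/existsP[u /existsP[v /and3P[]]]|no] :=
  boolP [exists u, exists v, [&& u \in X, v \notin X & closed_adj u v]].
  by exists u, v.
have step u v : u \in X -> e u v -> v \in X.
  move=> uX uv; apply: contraNT no => vX; apply/existsP; exists u.
  by apply/existsP; exists v; rewrite uX vX /closed_adj uv orbT.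
have clX : closed (induced e [set: T]) (mem X).
  move=> u v /and3P[_ _ uv]; apply/idP/idP=> ?; first exact: step uv.
  by apply: (step v) => //; rewrite e_sym.
have /forall_inP/(_ a (in_setT _))/forall_inP/(_ b (in_setT _)) := conn.
by move/(closed_connect clX) => E; move: bX; rewrite -[b \in X]E aX.
Qed.

Lemma cut_separation S : vertex_cut e S -> (forall v, #|S| < degree e v) ->
  exists A B, separation closed_adj S A B.
Proof.
set r := induced e (~: S) => /forall_inPn[x xS /forall_inPn[y yS nxy]] deg.
have r_sym : connect_sym r.
  by apply: sym_connect_sym => u v; rewrite /r /induced /= e_sym andbCA.
have out v : exists2 w, w \notin S & e v w.
  have /subsetPn[w] : ~~ ([set w | e v w] \subset S).
    by apply: contraL (deg v) => /subset_leq_card; rewrite -leqNgt.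
  by rewrite inE; exists w.
have rE u v : u \notin S -> v \notin S -> e u v -> connect r x u = connect r x v.
  move=> uS vS uv; have cuv : connect r u v by apply: connect1; rewrite /r /induced /= !inE uS vS.
  by rewrite !(r_sym x) (same_connect r_sym cuv).
(* [side true] is the component of [x] outside [S], and [side false] gathers all the others. *)
pose side b := [set z in ~: S | connect r x z == b].
have nbr b v : v \in side b -> exists2 w, w \in side b & (w != v) && closed_adj v w.
  rewrite !inE => /andP[vS /eqP cv]; have [w wS vw] := out v; exists w.
    by rewrite !inE wS -(rE v w) // cv eqxx.
  by rewrite /closed_adj vw orbT andbT; apply: contraTneq vw => ->; rewrite e_irr.
exists (side true), (side false); split; try exact: nbr.
- by move=> z; rewrite !inE; case: (z \in S) => //=; case: connect.
- by move=> z; rewrite !inE => /andP[].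
- by move=> z; rewrite !inE => /andP[].
- move=> a b; rewrite !inE => /andP[aS /eqP ca] /andP[bS /eqP cb].
  apply: contraFF cb => /orP[/eqP <- //|ab].
  by rewrite -(rE a b).
- by exists x; rewrite inE xS connect0.
- by exists y; rewrite inE yS eqbF_neg.
Qed.

(** The neighbours of [v] separate it from any non-neighbour; if there is none, the degree reaches
    the default [#|T|.-1]. *)
Lemma connectivity_le_min_degree : 0 < #|T| -> connectivity e <= min_degree e.
Proof.
move=> T0; rewrite leqNgt; apply/negP=> lt.
have [||v _] := @bigminn_attained _ xpredT (degree e) #|T| (connectivity e).
- exact: lt.
- by apply: leq_trans (bigminn_default _ _ _) (leq_pred _).
rewrite ltnNge => /negP[].
have [full|] := boolP [forall z, (z != v) ==> e v z].
  apply: leq_trans (bigminn_default _ _ _) _.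
  rewrite -(cardsC1 v) subset_leq_card //; apply/subsetP=> z; rewrite !inE => zv.
  by have /forallP/(_ z) := full; rewrite zv.
case/forallPn=> z; rewrite negb_imply => /andP[zv vz].
apply: (bigminn_inf (fun S : {set T} => #|S|)); apply/negP=> /forall_inP/(_ v).
rewrite !inE e_irr => /(_ isT)/forall_inP/(_ z); rewrite !inE vz => /(_ isT).
case/connectP=> [[|w p]] /=; first by move=> _ ezv; rewrite ezv eqxx in zv.
by rewrite /induced /= !inE => /andP[/and3P[_ /negP]].
Qed.

Lemma two_cut_in_G2 S A B I s x a0 a1 :
  (forall u v, ~~ closed_adj u v ->
     [\/ covers closed_adj u v, exists x, witness closed_adj u x v
       | exists x, witness closed_adj v x u]) ->
  (forall u x, closed_adj u x ->
     exists2 z, ~~ closed_adj u z & ~~ closed_adj x z) ->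
  (forall v, 2 < degree e v) -> separation closed_adj S A B ->
  independent_for closed_adj I -> two_cut closed_adj S A B I s x a0 a1 ->
  in_G2_33 e.
Proof.
move=> crit no2 deg sep ind tc; have dC := closed_adj_sym.
have [[u [uB xu xB]] sA cA cB] :=
  two_cut_complete closed_adj_refl closed_adj_sym no2 crit sep tc.
case: tc => defI defS sx a0B a1A xs xa0 xa1 xA sB _.
have S2 z : z \in S -> z = s \/ z = x.
  by rewrite defS !inE => /orP[]/eqP; [left|right].
have sS : s \in S by rewrite defS !inE eqxx.
have xS : x \in S by rewrite defS !inE eqxx orbT.
have outA z : z \in A -> [/\ (z == s) = false, (z == x) = false & (z \in B) = false].
  move=> zA; have zS := sep_SA sep zA.
  split; apply: contraNF zS; [by move/eqP->|by move/eqP->|move=> zB].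
  by have := sep_neq closed_adj_refl sep zA zB; rewrite eqxx.
have outB z : z \in B ->
    [/\ (z == s) = false, (z == x) = false, (z == a1) = false & (z \in A) = false].
  move=> zB; have zS := sep_SB sep zB.
  split; [by apply: contraNF zS => /eqP->|by apply: contraNF zS => /eqP->| |].
    by rewrite eq_sym (negbTE (sep_neq closed_adj_refl sep a1A zB)).
  by apply: contraTF zB => /outA[_ _ ->].
have [sA' sB'] : (s \in A) = false /\ (s \in B) = false.
  by split; apply: contraTF sS; [move/(sep_SA sep) | move/(sep_SB sep)].
have [xA' xB'] : (x \in A) = false /\ (x \in B) = false.
  by split; apply: contraTF xS; [move/(sep_SA sep) | move/(sep_SB sep)].
have [a1s a1x a1B] := outA _ a1A.
have sa0 : closed_adj s a0 = false.
  rewrite (independent_neq ind) // ?defI ?inE ?eqxx ?orbT //.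
  by apply: contraFneq sB' => ->.
have sa1 : closed_adj s a1 = false.
  rewrite (independent_neq ind) // ?defI ?inE ?eqxx ?orbT //.
  by rewrite eq_sym a1s.
(* Memberships are given as equations, so that the sixteen pairs of classes reduce by rewriting. *)
have classes z :
    [\/ [/\ z = s, (z == x) = false, (z == a1) = false, (z \in A) = false &
            (z \in B) = false],
        [/\ z = x, (z == s) = false, (z == a1) = false, (z \in A) = false &
            (z \in B) = false],
        [/\ z \in A, (z == s) = false, (z == x) = false & (z \in B) = false] |
        [/\ z \in B, (z == s) = false, (z == x) = false, (z == a1) = false &
            (z \in A) = false]].
  case/or3P: (sep_cover sep z) => [/S2[]->|zA|zB].
  - by constructor 1; rewrite sA' sB' (negbTE sx) eq_sym a1s.
  - by constructor 2; rewrite xA' xB' eq_sym (negbTE sx) eq_sym a1x.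
  - by have [*] := outA _ zA; constructor 3.
  - by have [*] := outB _ zB; constructor 4.
have dsA z : z \in A -> closed_adj s z = (z != a1).
  by move=> zA; have [->|za1] := eqVneq z a1; rewrite ?sa1 ?sA.
have dxA z : z \in A -> closed_adj x z = (z != a1).
  by move=> zA; have [->|za1] := eqVneq z a1; rewrite ?(negbTE xa1) ?xA.
have dsB z : z \in B -> closed_adj s z = (z != a0).
  by move=> zB; have [->|za0] := eqVneq z a0; rewrite ?sa0 ?sB.
have dxB z : z \in B -> closed_adj x z = (z != u).
  by move=> zB; have [->|zu] := eqVneq z u; rewrite ?(negbTE xu) ?xB.
have u1u2 : a0 != u by apply: contraNneq xu => <-.
exists (A :\ a1), B, a0, u, x, s, a1; split.
- split.
  + have : 2 < degree e a1 := deg a1; rewrite /degree => /leq_trans; apply.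
    apply/subset_leq_card/subsetP=> z; rewrite !inE adjE => /andP[a1z].
    rewrite eq_sym a1z; case/or3P: (sep_cover sep z) => // [/S2[]->|zB].
    * by rewrite dC sa1.
    * by rewrite dC (negbTE xa1).
    * by rewrite (sep_AB sep).
  + have : 2 < degree e a0 := deg a0; rewrite /degree => /leq_trans; apply.
    (* The neighbours of [a0] lie in [B :\ a0] and [x], a set as large as [B]. *)
    have -> : #|B| = #|x |: (B :\ a0)|.
      by rewrite cardsU1 !inE xB' andbF (cardsD1 a0 B) a0B.
    apply/subset_leq_card/subsetP=> z; rewrite !inE adjE => /andP[a0z].
    rewrite (eq_sym z a0) a0z; case/or3P: (sep_cover sep z) => [/S2[]->|zA|->].
    * by rewrite dC sa0.
    * by rewrite eqxx.
    * by rewrite dC (sep_AB sep).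
    * by rewrite orbT.
  + rewrite disjoint_subset; apply/subsetP=> z; rewrite !inE => /andP[_ zA].
    by have [_ _ ->] := outA _ zA.
- by split.
- split; first by rewrite /= !inE negb_or eq_sym sx eq_sym a1x eq_sym a1s.
  rewrite disjoint_subset; apply/subsetP=> z; rewrite !inE -orbA.
  by case/or3P=> /eqP->; rewrite ?xA' ?xB' ?sA' ?sB' ?a1B ?eqxx ?andbF.
- apply/setP=> z; rewrite !inE.
  have [[-> *]|[-> *]|[-> *]|[-> *]] := classes z; rewrite ?eqxx ?orbT //.
  by case: (z == a1); rewrite ?orbT.
- move=> y z; rewrite adjE /G2_edge /= !inE.
  have [[-> y1 y2 y3 y4]|[-> y1 y2 y3 y4]|[y1 y2 y3 y4]|[y1 y2 y3 y4 y5]] := classes y;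
  have [[-> z1 z2 z3 z4]|[-> z1 z2 z3 z4]|[z1 z2 z3 z4]|[z1 z2 z3 z4 z5]] := classes z;
  rewrite ?(y1, z1) ?(y2, z2) ?(y3, z3) ?(y4, z4) ?y5 ?z5 ?eqxx.
all: rewrite /= ?andbF ?orbF ?andbT ?andFb /=.
+ by [].
+ by rewrite dC.
+ by rewrite eq_sym z2 dsA.
+ by rewrite eq_sym z2 dsB.
+ by [].
+ by [].
+ by rewrite eq_sym z3 dxA.
+ by rewrite eq_sym z3 dxB.
+ by rewrite dC dsA.
+ by rewrite dC dxA.
+ rewrite cA // andbT (eq_sym z y).
  have [->|ya] := eqVneq y a1; have [ez|za] := eqVneq z a1; rewrite //=.
  * by rewrite ez ya.
  * by rewrite orbF orbb.
+ by rewrite (sep_AB sep) ?andbF.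
+ by rewrite dC dsB.
+ by rewrite dC dxB.
+ by rewrite dC (sep_AB sep) ?andbF.
+ by rewrite cB // andbT (eq_sym z y) orbb.
Qed.

End Graphs.

Theorem theorem3p8 (T : finType) (e : rel T)
    (e_sym : symmetric e) (e_irr : irreflexive e)
    (e_conn : connected_graph e) (e_crit : critical3 e)
    (e_notin : ~ in_G2_33 e) (q : nat) (hq : q = 1 \/ q = 2) :
  independence_number e = connectivity e + q <->
  independence_number e = min_degree e + q.
Proof.
have g3 : gamma_c e = 3 by case: e_crit.
have T3 : 3 <= #|T| by rewrite -g3; exact: bigminn_default.
have le_kd := connectivity_le_min_degree e_irr (ltnW (ltnW T3)).
have [ltkd|ledk] := ltnP (connectivity e) (min_degree e); last first.
  by have -> : connectivity e = min_degree e by apply/eqP; rewrite eqn_leq le_kd.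
(* Both equations then fail, as [q] is positive. *)
suff le_ak : independence_number e <= connectivity e.
  have q0 : 0 < q by case: hq => ->.
  have lt_ak : independence_number e < connectivity e + q.
    by apply: leq_ltn_trans le_ak _; rewrite -addn1 leq_add2l.
  have lt_ad : independence_number e < min_degree e + q.
    by apply: leq_trans lt_ak _; rewrite leq_add2r.
  by split=> ea; [rewrite ea ltnn in lt_ak | rewrite ea ltnn in lt_ad].
have no2 := gamma_c_no_dominating_edge e_sym g3.
have crit := critical_closed_adj e_sym e_crit.
have dxx := @closed_adj_refl _ e; have dC := closed_adj_sym e_sym.
have deg_ge v : min_degree e <= degree e v by exact: bigminn_inf.
(* Being below its default, the minimum is attained by an actual cut. *)
have lt_kT : connectivity e < #|T|.-1.
  have [v _] : exists v, v \in T by apply/card_gt0P; apply: ltnW (ltnW T3).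
  by rewrite -ltnS prednK; [apply: leq_trans (degree_lt e_irr v); rewrite ltnS;
    apply: leq_trans ltkd (deg_ge v) | apply: ltnW (ltnW T3)].
have [S cutS leS] := bigminn_attained (ltnSn (connectivity e)) lt_kT.
rewrite ltnS in leS.
have degS v : #|S| < degree e v.
  exact: leq_ltn_trans leS (leq_trans ltkd (deg_ge v)).
have [A [B sep]] := cut_separation e_sym e_irr cutS degS.
(* This bound yields both [2 < #|I|] and degrees above two. *)
have S1 := cut_gt1 dxx dC no2 crit sep (connected_graph_escape e_sym e_conn).
apply/bigmax_leqP=> I indI; rewrite leqNgt; apply/negP=> ltI.
have SI := leq_ltn_trans leS ltI.
have ind : independent_for (closed_adj e) I.
  move=> u v uI vI; rewrite /closed_adj.
  by have /forall_inP/(_ u uI)/forall_inP/(_ v vI)/negbTE-> := indI; rewrite orbF.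
have [s [x [a0 [a1 tc]]]] :=
  independent_two_cut dxx dC no2 crit sep ind SI (leq_ltn_trans S1 SI).
apply: e_notin.
have deg2 v : 2 < degree e v by exact: leq_ltn_trans S1 (degS v).
case: tc => tc; first exact: two_cut_in_G2 crit no2 deg2 sep ind tc.
exact: two_cut_in_G2 crit no2 deg2 (sepC dC sep) ind tc.
Qed.
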